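(* There are infinitely many Schenker primes.
   Context: For a positive integer $n$, the Schenker sum is $a_n = \sum_{j=0}^{n}\frac{n!}{j!}n^j$. A prime number $p$ is called a Schenker prime if there exists a positive integer $n$ such that $p\nmid n$ and $p\mid a_n$. *)

(* Defs.v *)
From mathcomp Require Import all_boot.
From mathcomp Require Import all_classical.

Set Implicit Arguments.
Unset Strict Implicit.
Unset Printing Implicit Defensive.

(* The quotient of factorials is exact, since j <= n. *)
Definition schenker_sum (n : nat) : nat :=
  \sum_(0 <= j < n.+1) (n`! %/ j`!) * n ^ j.

Definition schenker_prime (p : nat) : Prop :=
  prime p /\ exists n : nat, [/\ 0 < n, ~~ (p %| n) & p %| schenker_sum n].

(* Main.v *)
Require Import Defs.
From mathcomp Require Import all_boot.
From mathcomp Require Import all_classical.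
From mathcomp Require Import zify.

(** Suppose that the Schenker primes are finite in number, and let [n] be their
    product.  Every prime [p] dividing [a_n] must then divide [n]: otherwise [n]
    itself witnesses that [p] is a Schenker prime, hence a factor of [n].

    The key fact is that a prime [p] dividing [n] has the same valuation in
    [a_n] as in [n`!].  The term of index [j] satisfies
    [v_p ((n`! / j`!) * n ^ j) >= v_p (n`!) - v_p (j`!) + j], and
    [v_p (j`!) < j] for [j > 0], so the term [n`!] of index [0] is the only one
    of minimal valuation ([logn_fact_lt], [logn_schenker_sum]).

    Hence all valuations of [a_n] are at most those of [n`!], so that
    [a_n %| n`!].  This is absurd, because [a_n] exceeds its term [n`!] of
    index [0]. *)

Set Implicit Arguments.
Unset Strict Implicit.
Unset Printing Implicit Defensive.

Local Open Scope classical_set_scope.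

(** In Legendre's formula for [v_p (j`!)], each quotient [j %/ p ^ k.+1] is at
    most half of the preceding one, so the partial sums, started from [j],
    never reach [j]: the gap is at least the last quotient, and at least [1]. *)
Lemma logn_fact_lt (p j : nat) : prime p -> 0 < j -> logn p j`! < j.
Proof.
move=> p_pr j_gt0; have p_gt1 := prime_gt1 p_pr; rewrite logn_fact //.
suff: \sum_(1 <= k < j.+1) j %/ p ^ k + maxn 1 (j %/ p ^ j) <= j by lia.
(* The number of summands becomes a separate variable, while the [j] being
   divided stays fixed. *)
move: {1 4}j => m; elim: m => [|m IHm].
  by rewrite big_nil expn0 divn1; lia.
rewrite big_nat_recr //= expnSr divnMA.
set q := j %/ p ^ m in IHm *.
have : (q %/ p) * 2 <= q.
  by apply: leq_trans (leq_divM q p); rewrite leq_mul2l p_gt1 orbT.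
by lia.
Qed.

Lemma schenker_sum_recl (n : nat) :
  schenker_sum n = n`! + \sum_(1 <= j < n.+1) (n`! %/ j`!) * n ^ j.
Proof. by rewrite /schenker_sum big_ltn // fact0 divn1 expn0 muln1. Qed.

Lemma fact_lt_schenker_sum (n : nat) : 0 < n -> n`! < schenker_sum n.
Proof.
move=> n_gt0; rewrite schenker_sum_recl big_nat_recr //= divnn fact_gt0 mul1n.
by have : 0 < n ^ n by [rewrite expn_gt0 n_gt0]; lia.
Qed.

(** Writing [v] for [v_p (n`!)], the terms of positive index are all divisible
    by [p ^ v.+1], which leaves the valuation of the sum to the term [n`!]. *)
Lemma logn_schenker_sum (p n : nat) :
  prime p -> 0 < n -> p %| n -> logn p (schenker_sum n) = logn p n`!.
Proof.
move=> p_pr n_gt0 p_n; set v := logn p n`!.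
have tail : p ^ v.+1 %| \sum_(1 <= j < n.+1) (n`! %/ j`!) * n ^ j.
  rewrite big_nat; apply: dvdn_sum => j /andP[j_gt0 j_le].
  have j_fact : j`! %| n`! by rewrite -(@bin_fact n j j_le) mulnCA dvdn_mulr.
  have quo_gt0 : 0 < n`! %/ j`!.
    by rewrite divn_gt0 ?fact_gt0 // dvdn_leq ?fact_gt0.
  rewrite pfactor_dvdn ?muln_gt0 ?quo_gt0 ?expn_gt0 ?n_gt0 //.
  rewrite lognM ?expn_gt0 ?n_gt0 // lognX logn_div // -/v.
  have := logn_fact_lt p_pr j_gt0.
  have : 0 < logn p n by rewrite logn_gt0 mem_primes p_pr n_gt0.
  by nia.
have a_gt0 : 0 < schenker_sum n by apply: leq_trans (fact_lt_schenker_sum n_gt0).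
apply/eqP; rewrite eqn_leq -(pfactor_dvdn v p_pr a_gt0) leqNgt.
rewrite -(pfactor_dvdn v.+1 p_pr a_gt0) schenker_sum_recl dvdn_addl //.
rewrite pfactor_dvdn ?fact_gt0 // ltnn dvdn_addl ?pfactor_dvdnn //.
by apply: dvdn_trans tail; apply: dvdn_exp2l.
Qed.

Theorem proposition3 : infinite_set [set p : nat | schenker_prime p].
Proof.
move=> /finite_seqP[s s_def].
have sP p : p \in s <-> schenker_prime p.
  by have /(congr1 (fun A => A p)) /= -> := s_def.
pose n := \prod_(p <- s) p.
have n_gt0 : 0 < n.
  by rewrite /n big_seq prodn_cond_gt0 // => p /sP[/prime_gt0].
have s_dvd p : p \in s -> p %| n.
  by move=> p_s; rewrite /n (big_rem p p_s) dvdn_mulr.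
have a_gt := fact_lt_schenker_sum n_gt0.
suff /dvdn_leq : schenker_sum n %| n`! by rewrite fact_gt0 leqNgt a_gt => /(_ isT).
apply/dvdn_partP => [|p]; first exact: leq_trans a_gt.
rewrite mem_primes => /and3P[p_pr _ p_a].
have p_n : p %| n.
  apply: contraT => p_n; rewrite -(negbTE p_n); apply/s_dvd/sP.
  by split=> //; exists n.
by rewrite p_part logn_schenker_sum // pfactor_dvdnn.
Qed.
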